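(* Let $A\subseteq\mathcal C$ be a set. The following are equivalent: (i) $A$ is complete. (ii) For every finite partial type $p_0(\bar x)$ over $A$ (not necessarily realized in $A$) and every finite collection $\{\psi_i(\bar x,\bar b_i,\bar z_i):i<k\}$ of formulas over $A$, there are $\{\bar d_i:i<k\}\subseteq P^A$ such that $p_0(\bar x)\cup\{[(\exists\bar z_i\subseteq P)\psi_i(\bar x,\bar b_i,\bar z_i)]\to\psi_i(\bar x,\bar b_i,\bar d_i):i<k\}$ is consistent. (iii) For every finite partial type $p_0(\bar x)$ over $A$ and every formula $\psi(\bar x,\bar b,\bar z)$ over $A$, there is $\bar d\subseteq P^A$ such that $p_0(\bar x)\cup\{[(\exists\bar z\subseteq P)\psi(\bar x,\bar b,\bar z)]\to\psi(\bar x,\bar b,\bar d)\}$ is consistent. (iv) $P^A\prec P^{\mathcal C}$, and for every finite partial type $p_0(\bar x)$ over $A$ and every finite collection $\{\psi_i(\bar x,\bar b_i,\bar y_i):i<k\}$ of formulas over $A$, there are $\{\bar d_i:i<k\}\subseteq P^A$ such that $p_0(\bar x)\cup\{(\forall\bar y_i\subseteq P)[\psi_i(\bar x,\bar b_i,\bar y_i)\leftrightarrow\Psi_{\psi_i}(\bar y_i,\bar d_i)]:i<k\}$ is consistent, where $\Psi_{\psi_i}$ is the uniform defining formula for $\psi_i=\psi_i(\bar x\bar x^i,\bar y_i)$ (with $\mathrm{len}(\bar x^i)=\mathrm{len}(\bar b_i)$). (v) $P^A\prec P^{\mathcal C}$, and for every finite partial type $p_0(\bar x)$ over $A$ and every formula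 $\psi(\bar x,\bar b,\bar y)$ over $A$, there is $\bar d\subseteq P^A$ such that $p_0(\bar x)\cup\{(\forall\bar y\subseteq P)[\psi(\bar x,\bar b,\bar y)\leftrightarrow\Psi_{\psi}(\bar y,\bar d)]\}$ is consistent, where $\Psi_\psi$ is the uniform defining formula for $\psi=\psi(\bar x\bar x',\bar y)$.
   Context: Setting: $T$ is a complete first-order theory whose language contains a distinguished unary predicate $P$ and no function symbols (every subset is treated as a substructure), and $T$ implies $P$ is infinite. $\mathcal C$ is a monster model of $T$; all sets are subsets of $\mathcal C$. For a set $A$, $P^A=A\cap P^{\mathcal C}$; $\mathcal C^P$ is the substructure with universe $P^{\mathcal C}$, $T^P=\mathrm{Th}(\mathcal C^P)$, and $P^A\prec P^{\mathcal C}$ means $P^A$ is an elementary substructure of $\mathcal C^P$. Standing hypotheses: (1) every subset of $P^{\mathcal C}$ definable in $\mathcal C$ with parameters is definable with parameters from $P^{\mathcal C}$; (2) every subset of $P^{\mathcal C}$ that is $0$-definable in $\mathcal C$ is $0$-definable in $\mathcal C^P$; (3) $T$ has quantifier elimination. A set $A$ is complete if for every formula $\psi(\bar x,\bar y)$ and $\bar b\subseteq A$, if $\models(\exists \bar x\in P)\psi(\bar x,\bar b)$ then there is $\bar a\subseteq P\cap A$ with $\models\psi(\bar a,\bar b)$. Uniform definitions: for each formula $\psi(\bar x,\bar y)$ (with object variables $\bar x$ and parameter variables $\bar y$) a formula $\Psi_\psi(\bar y,\bar z)$ is fixed such that for every tuple $\bar a$ in $\mathcal C$ there is $\bar c\subseteq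 P^{\mathcal C}$ with $\mathcal C\models(\forall\bar y\subseteq P)[\psi(\bar a,\bar y)\leftrightarrow\Psi_\psi(\bar y,\bar c)]$ (such a family exists under the standing hypotheses). *)

(* Defs.v *)
From mathcomp Require Import all_boot.
From mathcomp Require Import boolp classical_sets functions cardinality.

Set Implicit Arguments.
Unset Strict Implicit.
Unset Printing Implicit Defensive.

Local Open Scope classical_set_scope.
Local Open Scope card_scope.

(* Relational first-order languages. The distinguished unary predicate P is
   not listed among the symbols [rsym]: it has its own constructor [fP] in
   formulas and its own field [interpP] in structures. Symbols of arity 0 are
   propositional constants; there are no function or constant symbols. *)
Record language := Language { rsym :> Type; arity : rsym -> nat }.

(* [form L V]: formulas whose free variables are indexed by the type V; a
   quantifier binds the variable [None]. A formula psi(x, y) in two tuples of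
   variables is a [form L ('I_n + 'I_m)], and a formula with parameters from a
   set A is a [form L ('I_n + A)]: the elements of A are then variables always
   evaluated at themselves, that is, constants naming the elements of A. *)
Inductive form (L : language) (V : Type) : Type :=
| fFalse
| fEq (x y : V)
| fP (x : V)
| fRel (r : L) (t : 'I_(arity r) -> V)
| fImp (f g : form L V)
| fAll (f : form L (option V)).

Arguments fFalse {L V}.
Arguments fEq {L V}.
Arguments fP {L V}.
Arguments fRel {L V}.
Arguments fImp {L V}.
Arguments fAll {L V}.

Definition fNot L (V : Type) (f : form L V) := fImp f fFalse.
Definition fAnd L (V : Type) (f g : form L V) := fNot (fImp f (fNot g)).
Definition fIff L (V : Type) (f g : form L V) := fAnd (fImp f g) (fImp g f).
Definition fEx L (V : Type) (f : form L (option V)) := fNot (fAll (fNot f)).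

Fixpoint quantifier_free L (V : Type) (f : form L V) : Prop :=
  match f with
  | fImp f1 f2 => quantifier_free f1 /\ quantifier_free f2
  | fAll _ => False
  | _ => True
  end.

Fixpoint rename L (V W : Type) (s : V -> W) (f : form L V) {struct f} :
    form L W :=
  match f with
  | fFalse => fFalse
  | fEq x y => fEq (s x) (s y)
  | fP x => fP (s x)
  | fRel r t => fRel r (fun i => s (t i))
  | fImp f1 f2 => fImp (rename s f1) (rename s f2)
  | fAll f1 => fAll (rename (omap s) f1)
  end.

Definition sumval (V W X : Type) (v : V -> X) (w : W -> X) (z : V + W) : X :=
  match z with inl x => v x | inr y => w y end.

Definition optval (V X : Type) (v : V -> X) (a : X) (z : option V) : X :=
  match z with Some x => v x | None => a end.

(* Bounded quantification over the tuple of variables in the right summand: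
   (exists z subset P) f  and  (forall z subset P) f. *)
Definition unbind (V : Type) l (z : V + 'I_l.+1) : option V + 'I_l :=
  match z with
  | inl x => inl (Some x)
  | inr j => match unlift ord0 j with
             | Some j' => inr j'
             | None => inl None
             end
  end.

Definition unbind0 (V : Type) (z : V + 'I_0) : V :=
  match z with
  | inl x => x
  | inr j => False_rect V (notF (ltn_ord j))
  end.

Fixpoint exP L (V : Type) l : form L (V + 'I_l) -> form L V :=
  match l with
  | 0 => fun f => rename (@unbind0 V) f
  | l'.+1 => fun f =>
      fEx (fAnd (fP None) (exP (rename (@unbind V l') f)))
  end.

Fixpoint allP L (V : Type) l : form L (V + 'I_l) -> form L V :=
  match l with
  | 0 => fun f => rename (@unbind0 V) f
  | l'.+1 => fun f =>
      fAll (fImp (fP None) (allP (rename (@unbind V l') f)))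
  end.

Record structure (L : language) := Structure {
  carrier :> Type;
  interpP : set carrier;
  interp : forall r : L, set ('I_(arity r) -> carrier) }.

Fixpoint sat L (M : structure L) (V : Type) (f : form L V) {struct f} :
    (V -> M) -> Prop :=
  match f with
  | fFalse => fun _ => False
  | fEq x y => fun v => v x = v y
  | fP x => fun v => interpP (v x)
  | fRel r t => fun v => interp (fun i => v (t i))
  | fImp f1 f2 => fun v => sat f1 v -> sat f2 v
  | fAll f1 => fun v => forall a : M, sat f1 (optval v a)
  end.

(* P^A, for a subset A of M; the set P^M itself is [interpP M]. *)
Definition Pset L (M : structure L) (A : set M) : set M := A `&` @interpP L M.

(* The language being relational, every subset carries a substructure. *)
Definition substr L (M : structure L) (A : set M) : structure L :=
  @Structure L A (fun a => interpP (val a))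
    (fun r t => interp (fun i => val (t i))).

(* A < B: the substructure of M on A is an elementary substructure of the
   substructure of M on B. *)
Definition elem_sub L (M : structure L) (A B : set M) : Prop :=
  exists AB : A `<=` B, forall n (f : form L 'I_n) (v : 'I_n -> A),
    @sat L (substr A) _ f v <-> @sat L (substr B) _ f (fun i => subfun AB (v i)).

Definition sentence L := form L void.
Definition holds L (M : structure L) (f : sentence L) := sat f (of_void M).
Definition model L (T : set (sentence L)) (M : structure L) : Prop :=
  forall f, T f -> holds M f.
Definition entails L (T : set (sentence L)) (f : sentence L) : Prop :=
  forall M : structure L, model T M -> holds M f.

Definition complete_theory L (T : set (sentence L)) : Prop :=
  (exists M : structure L, model T M) /\
  forall f, entails T f \/ entails T (fNot f).

Definition P_infinite L (T : set (sentence L)) : Prop :=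
  forall M : structure L, model T M -> infinite_set (@interpP L M).

Definition quantifier_elimination L (T : set (sentence L)) : Prop :=
  forall n (f : form L 'I_n), exists g : form L 'I_n, quantifier_free g /\
    forall M : structure L, model T M -> forall v : 'I_n -> M,
      sat f v <-> sat g v.

Definition definable0 L (M : structure L) n (X : set ('I_n -> M)) : Prop :=
  exists f : form L 'I_n, X = [set v | sat f v].

Definition definable L (M : structure L) (A : set M) n
    (X : set ('I_n -> M)) : Prop :=
  exists f : form L ('I_n + A), X = [set v | sat f (sumval v val)].

(* "Subset of P" means a subset of a Cartesian power of P. *)
Definition stably_embedded L (M : structure L) : Prop :=
  forall n (X : set ('I_n -> M)),
    X `<=` [set v | forall i, interpP (v i)] ->
    definable setT X -> definable (@interpP L M) X.

Definition no_new_structure L (M : structure L) : Prop :=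
  forall n (X : set ('I_n -> M)),
    X `<=` [set v | forall i, interpP (v i)] ->
    definable0 X ->
    @definable0 L (substr (@interpP L M)) n
      [set w | X (fun i => val (w i))].

(* Consistency of a set p(x) of formulas over A with the theory of M in the
   language with constants for the elements of A ([form L A] being the type of
   sentences of that language): some model N of that theory, in which c
   interprets the constants, realizes p. *)
Definition consistent L (M : structure L) (A : set M) n
    (p : set (form L ('I_n + A))) : Prop :=
  exists (N : structure L) (c : A -> N),
    (forall f : form L A, sat f c <-> @sat L M _ f val) /\
    exists x : 'I_n -> N, forall f, p f -> sat f (sumval x c).

Definition finite_partial_type L (M : structure L) (A : set M) n
    (p : set (form L ('I_n + A))) : Prop :=
  finite_set p /\ consistent p.

Definition realized L (M : structure L) (A : set M) n
    (p : set (form L ('I_n + A))) : Prop :=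
  exists x : 'I_n -> M, forall f, p f -> sat f (sumval x val).

(* |A| < |K|, the type K standing for a cardinal. *)
Definition small (K U : Type) (A : set U) : Prop :=
  (A #<= [set: K]) /\ ~ ([set: K] #<= A).

Definition automorphism L (M : structure L) (g : M -> M) : Prop :=
  [/\ bijective g,
      forall a, interpP (g a) <-> interpP a
    & forall r (t : 'I_(arity r) -> M),
        interp (fun i => g (t i)) <-> interp t].

Definition elementary_map L (M : structure L) (A : set M) (h : A -> M) : Prop :=
  forall n (f : form L 'I_n) (v : 'I_n -> A),
    sat f (fun i => h (v i)) <-> @sat L M _ f (fun i => val (v i)).

(* K-saturated and strongly K-homogeneous models, for a cardinal K larger than
   the number |L| + aleph_0 of formulas. *)
Record monster L (T : set (sentence L)) (K : Type) (C : structure L) : Prop :=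
  Monster {
    monster_large : small K [set: form L nat];
    monster_model : model T C;
    monster_saturated : forall A : set C, small K A ->
      forall n (p : set (form L ('I_n + A))), consistent p -> realized p;
    monster_homogeneous : forall A : set C, small K A ->
      forall h : A -> C, elementary_map h ->
      exists g : C -> C, automorphism g /\ forall a : A, g (val a) = h a }.

Definition complete_set L (M : structure L) (A : set M) : Prop :=
  forall n m (psi : form L ('I_n + 'I_m)) (b : 'I_m -> A),
    (exists a : 'I_n -> M,
       (forall i, interpP (a i)) /\
       sat psi (sumval a (fun j => val (b j)))) ->
    exists a : 'I_n -> M,
      (forall i, Pset A (a i)) /\
      sat psi (sumval a (fun j => val (b j))).

(* psi(a, y) <-> Psi(y, c), as a formula in the variables V and y, where a and
   c are tuples of variables from V. *)
Definition def_equiv L (V : Type) n l r (psi : form L ('I_n + 'I_l))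
    (Psi : form L ('I_l + 'I_r)) (a : 'I_n -> V) (c : 'I_r -> V) :
    form L (V + 'I_l) :=
  fIff (rename (sumval (fun i => inl (a i)) inr) psi)
       (rename (sumval inr (fun j => inl (c j))) Psi).

(* A choice of uniform defining formulas Psi_psi(y, z), one for each psi(x, y);
   the length [udef_len] of z depends on psi. *)
Record uniform_definitions L (M : structure L) := UniformDefinitions {
  udef_len : forall n l, form L ('I_n + 'I_l) -> nat;
  udef : forall n l (psi : form L ('I_n + 'I_l)),
    form L ('I_l + 'I_(udef_len psi));
  udefP : forall n l (psi : form L ('I_n + 'I_l)) (a : 'I_n -> M),
    exists c : 'I_(udef_len psi) -> M,
      (forall j, interpP (c j)) /\
      sat (allP (def_equiv psi (udef psi) inl inr)) (sumval a c) }.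

Arguments udef_len {L M} u {n l} psi.
Arguments udef {L M} u {n l} psi.

(* The tuple (x, b), for x the first n variables. *)
Definition with_params n m (A : Type) (b : 'I_m -> A) (i : 'I_(n + m)) :
    'I_n + A :=
  match fintype.split i with inl j => inl j | inr j => inr (b j) end.

(* [(exists z subset P) psi(x, b, z)] -> psi(x, b, d) *)
Definition witness_form L n m l (A : Type) (psi : form L ('I_(n + m) + 'I_l))
    (b : 'I_m -> A) (d : 'I_l -> A) : form L ('I_n + A) :=
  fImp
    (exP (rename (sumval (fun i => inl (with_params b i)) inr) psi))
    (rename (sumval (with_params b) (fun j => inr (d j))) psi).

(* (forall y subset P) [psi(x, b, y) <-> Psi_psi(y, d)], where Psi_psi is taken
   for psi with object variables x x' and x' is replaced by b. *)
Definition definition_form L (M : structure L) (U : uniform_definitions M)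
    n m l (A : Type) (psi : form L ('I_(n + m) + 'I_l))
    (b : 'I_m -> A) (d : 'I_(udef_len U psi) -> A) : form L ('I_n + A) :=
  allP (def_equiv psi (udef U psi) (with_params b) (fun j => inr (d j))).

Arguments definition_form {L M} U {n m l A} psi b d.

Lemma sat_rename L (M : structure L) (V W : Type) (s : V -> W) (f : form L V)
    (v : W -> M) : sat (rename s f) v <-> sat f (fun x => v (s x)).
Proof.
elim: f W s v => {V} [V|V x y|V x|V r t|V f IHf g IHg|V f IH] W s v //=.
  by split=> fg; move/IHf/fg/IHg.
split=> h a; [have /IH := h a|apply/IH; have := h a];
  by congr sat; apply/funext; case.
Qed.

Lemma sat_fAnd L (M : structure L) (V : Type) (f g : form L V) (v : V -> M) :
  sat (fAnd f g) v <-> sat f v /\ sat g v.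
Proof.
split=> /= [h|[hf hg] /(_ hf hg)//].
by split; apply: contrapT => k; apply: h => ? ?.
Qed.

Lemma sat_fEx L (M : structure L) (V : Type) (f : form L (option V))
    (v : V -> M) :
  sat (fEx f) v <-> exists a : M, sat f (optval v a).
Proof.
split=> /= [h|[a ha] /(_ a ha)//].
by apply: contrapT => k; apply: h => a ha; apply: k; exists a.
Qed.

Definition tuple_cons (X : Type) l (a : X) (w : 'I_l -> X) (j : 'I_l.+1) : X :=
  if unlift ord0 j is Some j' then w j' else a.

Lemma tuple_consE (X : Type) l (w : 'I_l.+1 -> X) :
  tuple_cons (w ord0) (fun j => w (lift ord0 j)) = w.
Proof. by apply/funext => j; rewrite /tuple_cons; case: unliftP => [j'|] ->. Qed.

Lemma sumval_unbind (V X : Type) l (v : V -> X) (a : X) (w : 'I_l -> X) :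
  (fun z => sumval (optval v a) w (unbind z)) = sumval v (tuple_cons a w).
Proof. by apply/funext => -[x|j] //=; rewrite /tuple_cons; case: unlift. Qed.

Lemma sumval_unbind0 (V X : Type) (v : V -> X) (w : 'I_0 -> X) :
  (fun z => v (unbind0 z)) = sumval v w.
Proof. by apply/funext => -[x|[]]. Qed.

Lemma sat_exP L (M : structure L) (V : Type) l (f : form L (V + 'I_l))
    (v : V -> M) :
  sat (exP f) v <->
  exists w : 'I_l -> M, (forall j, interpP (w j)) /\ sat f (sumval v w).
Proof.
elim: l V f v => [|l IH] V f v.
  rewrite [exP f]/= sat_rename; split=> [h|[w [_ h]]]; last first.
    by rewrite (sumval_unbind0 v w).
  have w : 'I_0 -> M by case.
  by exists w; split; [case|rewrite -sumval_unbind0].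
rewrite [exP f]/= sat_fEx; split=> [[a /sat_fAnd[/= aP /IH[w [wP]]]]|[w [wP h]]].
  rewrite sat_rename sumval_unbind => h; exists (tuple_cons a w); split=> // j.
  by rewrite /tuple_cons; case: unlift.
exists (w ord0); apply/sat_fAnd; split; first exact: wP.
apply/IH; exists (fun j => w (lift ord0 j)); split=> //.
by rewrite sat_rename sumval_unbind tuple_consE.
Qed.

Lemma sat_allP L (M : structure L) (V : Type) l (f : form L (V + 'I_l))
    (v : V -> M) :
  sat (allP f) v <->
  forall w : 'I_l -> M, (forall j, interpP (w j)) -> sat f (sumval v w).
Proof.
elim: l V f v => [|l IH] V f v.
  rewrite [allP f]/= sat_rename; split=> [h w _|h].
    by rewrite -sumval_unbind0.
  have w : 'I_0 -> M by case.
  by rewrite (sumval_unbind0 v w); apply: h; case.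
split=> /= [h w wP|h a aP].
  have /IH/(_ (fun j => w (lift ord0 j))) := h (w ord0) (wP _).
  by rewrite sat_rename sumval_unbind tuple_consE; apply=> j; apply: wP.
apply/IH => w wP; rewrite sat_rename sumval_unbind; apply: h => j.
by rewrite /tuple_cons; case: unlift.
Qed.

(* Main.v *)
(* A finite set of formulas over A is consistent exactly when it is realized
   in C, so a complete set A allows one to enlarge a finite type p(x) by
   chi(x, d) for some d in P^A as soon as every x admits such a d in P: apply
   completeness to the formula [exists x, p(x) /\ chi(x, z)] in z. Adding the
   formulas one at a time, (ii) and the second half of (iv) are the cases where
   chi(x, z) says that z is a witness (any z in P will do if there is none), or
   that z defines the trace of psi(x, b, -) on P. Conversely, for the empty
   tuple x, (iii) is completeness itself, which implies P^A < P^C by the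
   Tarski-Vaught test; and (v) turns "psi(y, b) has a solution y in P" into
   "Psi(y, d) has one", with d in P^A, a statement about P^C which reflects down
   to P^A. *)
Require Import Defs.
From mathcomp Require Import all_boot.
From mathcomp Require Import boolp classical_sets functions cardinality.

Set Implicit Arguments.
Unset Strict Implicit.
Unset Printing Implicit Defensive.

Local Open Scope classical_set_scope.

(** * Formulas as finite objects: supports, existential closure, conjunctions *)

(** Separates, in a finite tuple of variables, those from [V], collected in a finite tuple [b] of
    parameters, from those in [W]. The indices of [s] can serve for [b], with a filler [v0] wherever
    [s] is in [W]; if [V] is empty there is nothing to collect. *)
Lemma factor_inl (V W : Type) k (s : 'I_k -> V + W) :
  exists m (b : 'I_m -> V) (t : 'I_k -> 'I_m + W),
    s = fun i => sumval (fun j => inl (b j)) inr (t i).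
Proof.
have [[v0]|V0] := pselect (inhabited V).
  exists k, (fun i => if s i is inl v then v else v0),
    (fun i => if s i is inr w then inr w else inl i).
  by apply/funext => i; case E: (s i) => [v|w] //=; rewrite E.
have t i : {w | s i = inr w}.
  by case: (s i) => [v|w]; [case: V0|exists w].
exists 0, (fun j : 'I_0 => False_rect V (notF (ltn_ord j))),
  (fun i => inr (sval (t i))).
by apply/funext => i /=; case: (t i).
Qed.

Lemma rename_comp (L : language) (V W X : Type) (s : V -> W) (t : W -> X)
    (f : form L V) : rename t (rename s f) = rename (fun x => t (s x)) f.
Proof.
elim: f W X s t => {V} [V|V x y|V x|V r u|V f IHf g IHg|V f IH] W X s t //=.
  by rewrite IHf IHg.
by rewrite IH; congr fAll; congr rename; apply/funext; case.
Qed.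

(** Leads from formulas with an arbitrary set of constants to the finitely many variables that
    [complete_set] speaks of. *)
Lemma form_finite_support (L : language) (V : Type) (f : form L V) :
  exists n (g : form L 'I_n) (s : 'I_n -> V), f = rename s g.
Proof.
elim: f => {V} [V|V x y|V x|V r u|V f [n [g [s ->]]] h [n' [g' [s' ->]]]
  |V f [n [g [s ->]]]].
- exists 0, fFalse.
  by exists (fun j : 'I_0 => False_rect V (notF (ltn_ord j))).
- exists 2, (fEq ord0 (lift ord0 ord0)).
  by exists (fun i : 'I_2 => if i == ord0 then x else y).
- by exists 1, (fP ord0), (fun=> x).
- by exists (arity r), (fRel r id), u.
- exists (n + n'), (fImp (rename (@lshift n n') g) (rename (@rshift n n') g')).
  exists (fun i => sumval s s' (fintype.split i)); rewrite /= !rename_comp.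
  congr fImp; congr rename; apply/funext => i.
    by rewrite (unsplitK (inl i)).
  by rewrite (unsplitK (inr i)).
(* The bound variable [None] may occur several times in [s]. Viewing [option V] as [V + unit] sets
   these occurrences apart, and only free variables enter the new tuple [b]. *)
- have [m [b [t E]]] :=
    factor_inl (fun i => if s i is Some v then inl v else inr tt).
  exists m, (fAll (rename (fun i => sumval Some (fun=> None) (t i)) g)), b.
  rewrite /= rename_comp; congr fAll; congr rename; apply/funext => i.
  move/(congr1 (fun u => u i)): E.
  by case: (s i) => [v|]; case: (t i) => //= j [->].
Qed.

Lemma sat_rename_swap (L : language) (M : structure L) (V W : Type)
    (f : form L (V + W)) (v : V -> M) (w : W -> M) :
  sat (rename (sumval inr inl) f) (sumval w v) <-> sat f (sumval v w).
Proof.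
rewrite sat_rename; suff -> : (fun z => sumval w v (sumval inr inl z)) =
  sumval v w by [].
by apply/funext; case.
Qed.

Lemma sat_exists (L : language) (V : Type) l (f : form L ('I_l + V)) :
  exists g : form L V, forall (M : structure L) (v : V -> M),
    sat g v <-> exists w : 'I_l -> M, sat f (sumval w v).
Proof.
(* [unbind] moves one variable out of the right summand, so the induction on [l], with [V] varying,
   is run on the swapped sum. *)
suff H : forall f : form L (V + 'I_l),
  exists g : form L V, forall (M : structure L) (v : V -> M),
    sat g v <-> exists w : 'I_l -> M, sat f (sumval v w).
  have [g Hg] := H (rename (sumval inr inl) f).
  exists g => M v; rewrite Hg.
  by split=> -[w /sat_rename_swap h]; exists w => //; apply/sat_rename_swap.
move=> {f}; elim: l V => [|l IH] V f.
  exists (rename (@unbind0 V) f) => M v; rewrite sat_rename.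
  split=> [h|[w h]]; last by rewrite (sumval_unbind0 v w).
  have w : 'I_0 -> M by case.
  by exists w; rewrite -sumval_unbind0.
have [g Hg] := IH _ (rename (@Defs.unbind V l) f).
exists (fEx g) => M v; rewrite sat_fEx; split=> [[a /Hg[w]]|[w h]].
  by rewrite sat_rename sumval_unbind => h; exists (tuple_cons a w).
exists (w ord0); apply/Hg; exists (fun j => w (lift ord0 j)).
by rewrite sat_rename sumval_unbind tuple_consE.
Qed.

Lemma finite_conjunction (L : language) (V : Type) (p : set (form L V)) :
  finite_set p -> exists f : form L V, forall (M : structure L) (v : V -> M),
    sat f v <-> forall g, p g -> sat g v.
Proof.
move=> /(@finite_seqP {classic form L V})[s ->].
elim: s => [|g s [f Hf]]; first by exists (fNot fFalse) => M v; split=> [_ g|_].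
exists (fAnd g f) => M v; rewrite sat_fAnd Hf; split.
  by move=> [hg hs] h; rewrite /= inE => /predU1P[->|/hs].
move=> h; split=> [|h' h's]; apply: h; rewrite /= inE ?eqxx//.
by apply/orP; right.
Qed.

(** * Meaning of the witness and definition formulas *)

Lemma sat_def_equiv (L : language) (M : structure L) (V : Type) n l r
    (psi : form L ('I_n + 'I_l)) (Psi : form L ('I_l + 'I_r))
    (a : 'I_n -> V) (c : 'I_r -> V) (v : V -> M) (w : 'I_l -> M) :
  sat (def_equiv psi Psi a c) (sumval v w) <->
  (sat psi (sumval (fun i => v (a i)) w) <->
   sat Psi (sumval w (fun j => v (c j)))).
Proof.
have E1 : (fun z => sumval v w (sumval (fun i => inl (a i)) inr z)) =
  sumval (fun i => v (a i)) w by apply/funext; case.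
have E2 : (fun z => sumval v w (sumval inr (fun j => inl (c j)) z)) =
  sumval w (fun j => v (c j)) by apply/funext; case.
by rewrite sat_fAnd /= !sat_rename E1 E2; split=> -[].
Qed.

Lemma sumval_with_params n m (A X : Type) (b : 'I_m -> A) (x : 'I_n -> X)
    (c : A -> X) i :
  sumval x c (with_params b i) = sumval x (fun j => c (b j)) (fintype.split i).
Proof. by rewrite /with_params; case: fintype.split. Qed.

Lemma sumval_split0 m (X : Type) (x : 'I_0 -> X) (c : 'I_m -> X) :
  (fun i : 'I_(0 + m) => sumval x c (fintype.split i)) = c.
Proof.
apply/funext => i; case: splitP => [[]//|k E] /=.
by congr c; apply/val_inj.
Qed.

(** [A] and [c] are arbitrary here because the constants will range over a set and also over a sum
    [A + 'I_l], in which [d] is a tuple of variables. *)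
Lemma sat_witness_form (L : language) (M : structure L) n m l (A : Type)
    (psi : form L ('I_(n + m) + 'I_l)) (b : 'I_m -> A) (d : 'I_l -> A)
    (x : 'I_n -> M) (c : A -> M) :
  let xb i := sumval x (fun j => c (b j)) (fintype.split i) in
  sat (witness_form psi b d) (sumval x c) <->
  ((exists w : 'I_l -> M, (forall j, interpP (w j)) /\ sat psi (sumval xb w)) ->
   sat psi (sumval xb (fun j => c (d j)))).
Proof.
move=> xb; have E1 (w : 'I_l -> M) : (fun z => sumval (sumval x c) w
    (sumval (fun i => inl (with_params b i)) inr z)) = sumval xb w.
  by apply/funext; case=> //= i; rewrite sumval_with_params.
have E2 : (fun z => sumval x c (sumval (with_params b) (fun j => inr (d j)) z)) =
    sumval xb (fun j => c (d j)).
  by apply/funext; case=> //= i; rewrite sumval_with_params.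
rewrite /= sat_rename E2 sat_exP.
by split=> h [w [wP hw]]; apply: h; exists w; move: hw; rewrite sat_rename E1.
Qed.

Lemma sat_definition_form (L : language) (M N : structure L)
    (U : uniform_definitions M) n m l (A : Type)
    (psi : form L ('I_(n + m) + 'I_l)) (b : 'I_m -> A)
    (d : 'I_(udef_len U psi) -> A) (x : 'I_n -> N) (c : A -> N) :
  let xb i := sumval x (fun j => c (b j)) (fintype.split i) in
  sat (definition_form U psi b d) (sumval x c) <->
  forall w : 'I_l -> N, (forall j, interpP (w j)) ->
    (sat psi (sumval xb w) <-> sat (udef U psi) (sumval w (fun j => c (d j)))).
Proof.
move=> xb; have E : (fun i => sumval x c (with_params b i)) = xb.
  by apply/funext => i; rewrite sumval_with_params.
rewrite sat_allP; split=> h w /h; last by move=> k; apply/sat_def_equiv; rewrite E.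
by move/sat_def_equiv; rewrite E.
Qed.

(** * Relativization to P *)

Fixpoint relativize (L : language) (V : Type) (f : form L V) : form L V :=
  match f with
  | fImp f1 f2 => fImp (relativize f1) (relativize f2)
  | fAll f1 => fAll (fImp (fP None) (relativize f1))
  | _ => f
  end.

Lemma optval_val (V X : Type) (B : set X) (v : V -> B) (a : B) :
  optval (fun x => val (v x)) (val a) = (fun z => val (optval v a z)).
Proof. by apply/funext; case. Qed.

Lemma sat_relativize (L : language) (M : structure L) (V : Type)
    (f : form L V) (v : V -> @interpP L M) :
  sat (relativize f) (fun x => val (v x)) <->
  @sat L (substr (@interpP L M)) V f v.
Proof.
elim: f v => {V} //= [V x y v|V f IHf g IHg v|V f IH v].
- by split=> [/val_inj|->].
- by split=> fg /IHf/fg/IHg.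
split=> h a; first by apply/IH; rewrite -optval_val; apply: h; apply: set_valP.
by move=> /= aP; have /IH := h (SigSub (mem_set aP)); rewrite -optval_val.
Qed.

(** * Finite types, complete sets and elementarity of P^A *)

Section Completeness.
Context (L : language) (M : structure L) (A : set M).

(** That a finite set has a realization is expressed by a single formula [g] over [A], on which [N]
    and [M] agree. *)
Lemma finite_consistentP n (p : set (form L ('I_n + A))) :
  finite_set p -> consistent p <-> realized p.
Proof.
move=> /finite_conjunction[f Hf]; split.
  have [g Hg] := sat_exists f.
  move=> [N [c [cE [x px]]]]; have /cE/Hg[w /Hf pw] : sat g c.
    by apply/Hg; exists x; apply/Hf.
  by exists w.
by move=> [x px]; exists M, val; split=> //; exists x.
Qed.

Lemma sub_consistent n (p q : set (form L ('I_n + A))) :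
  p `<=` q -> consistent q -> consistent p.
Proof.
move=> pq [N [c [cE [x qx]]]]; exists N, c; split=> //.
by exists x => f /pq/qx.
Qed.

(** A formula mentions only finitely many constants, so completeness extends to formulas having all
    of [A] as constants. *)
Lemma complete_set_form (A_complete : complete_set A) l
    (f : form L (A + 'I_l)) :
  (exists c : 'I_l -> M, (forall j, interpP (c j)) /\ sat f (sumval val c)) ->
  exists d : 'I_l -> A, (forall j, Pset A (val (d j))) /\
    sat f (sumval val (fun j => val (d j))).
Proof.
have [k [g [s ->]]] := form_finite_support f.
have [m [b [t ->]]] := factor_inl s.
have E (c : 'I_l -> M) :
    sat (rename (fun i => sumval (fun j => inl (b j)) inr (t i)) g)
      (sumval val c) <->
    sat (rename (fun i => sumval inr inl (t i)) g)
      (sumval c (fun j => val (b j))).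
  rewrite !sat_rename; suff -> : (fun i =>
      sumval val c (sumval (fun j => inl (b j)) inr (t i))) =
      (fun i => sumval c (fun j => val (b j)) (sumval inr inl (t i))) by [].
  by apply/funext => i; case: (t i).
move=> [c [cP /E h]].
have [a [aP /E ha]] := A_complete _ _ _ _ (ex_intro _ c (conj cP h)).
have aA j : A (a j) by have [] := aP j.
by exists (fun j => SigSub (mem_set (aA j))).
Qed.

(* The variables A + 'I_l of chi are constants from A and the tuple z, so that
   F d is meant to be chi(x, d). *)
Lemma complete_set_extend (A_complete : complete_set A) n l
    (p : set (form L ('I_n + A))) (chi : form L ('I_n + (A + 'I_l)))
    (F : ('I_l -> A) -> form L ('I_n + A)) :
  finite_partial_type p ->
  (forall d x, sat (F d) (sumval x val) <->
     sat chi (sumval x (sumval val (fun j => val (d j))))) ->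
  (forall x : 'I_n -> M, exists c : 'I_l -> M,
     (forall j, interpP (c j)) /\ sat chi (sumval x (sumval val c))) ->
  exists d : 'I_l -> A, (forall j, Pset A (val (d j))) /\
    finite_partial_type (p `|` [set F d]).
Proof.
move=> [pfin pcons] FE chiP.
have [f Hf] := finite_conjunction pfin.
have [x px] := (finite_consistentP pfin).1 pcons.
have [c [cP chic]] := chiP x.
have [g Hg] := sat_exists
  (fAnd (rename (sumval inl (fun a => inr (inl a))) f) chi).
have fE (y : 'I_n -> M) (e : 'I_l -> M) :
    sat (rename (sumval inl (fun a => inr (inl a))) f) (sumval y (sumval val e))
    <-> forall h, p h -> sat h (sumval y val).
  rewrite -Hf sat_rename; suff -> : (fun z : 'I_n + A => sumval y (sumval val e)
      (sumval inl (fun a => inr (inl a)) z)) = sumval y val by [].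
  by apply/funext; case.
have [|d [dP /Hg[y /sat_fAnd[/fE py /FE Fy]]]] :=
    complete_set_form A_complete (f := g).
  exists c; split=> //; apply/Hg; exists x; apply/sat_fAnd.
  by split=> //; apply/fE.
exists d; split=> //.
have qfin : finite_set (p `|` [set F d]) by rewrite finite_setU.
split=> //; apply/finite_consistentP => //.
by exists y => h [/py//|->].
Qed.

(** Indices are treated one at a time: each stage is again a finite partial type, to which [step]
    applies. The type [D i] varies with [i] because the tuples have different lengths. *)
Lemma extend_family n (p : set (form L ('I_n + A))) k
    (D : 'I_k -> Type) (Q : forall i, set (D i))
    (F : forall i, D i -> form L ('I_n + A)) :
  finite_partial_type p ->
  (forall i (q : set (form L ('I_n + A))), finite_partial_type q ->
     exists d : D i, Q i d /\ finite_partial_type (q `|` [set F i d])) ->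
  exists d : forall i, D i, (forall i, Q i (d i)) /\
    consistent (p `|` range (fun i => F i (d i))).
Proof.
move=> pfin step.
have [q [qfin pq Hq]] : exists q, [/\ finite_partial_type q, p `<=` q &
    forall i, i \in enum 'I_k -> exists d, Q i d /\ q (F i d)].
  elim: (enum _) => [|i s [q [qfin pq Hq]]]; first by exists p; split.
  have [d [Qd dfin]] := step i q qfin.
  exists (q `|` [set F i d]); split=> //.
    by apply: (subset_trans pq); exact: subsetUl.
  move=> j; rewrite inE => /predU1P[->|/Hq[e [Qe qe]]].
    by exists d; split=> //; right.
  by exists e; split=> //; left.
(* The chosen [d] may differ from the one used in building [q]; it is enough that its formula lies
   in [q]. *)
have d i : {d | Q i d /\ q (F i d)} by apply/cid/Hq; rewrite mem_enum.
exists (fun i => sval (d i)); split=> [i|]; first by case: (svalP (d i)).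
case: qfin => _; apply: sub_consistent => h [/pq//|[i _ <-]].
by case: (svalP (d i)).
Qed.

(** The Tarski-Vaught argument: by completeness, a counterexample in P to a universal formula can be
    replaced by one in P^A. *)
Lemma complete_set_sat_substr (A_complete : complete_set A) (V : Type)
    (f : form L V) (v : V -> Pset A) :
  @sat L (substr (Pset A)) V f v <-> sat (relativize f) (fun x => val (v x)).
Proof.
elim: f v => {V} //= [V x y v|V f IHf g IHg v|V f IH v].
- by split=> [->|/val_inj].
- by split=> fg /IHf/fg/IHg.
split=> h a; last first.
  by apply/IH; rewrite -optval_val; apply: h; have [] := set_valP a.
move=> aP; apply: contrapT => na.
pose inA : Pset A -> A := subfun (@subIsetl _ A (@interpP L M)).
(* Free variables become constants of [A]; the bound one becomes the tuple of length 1 sought in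
   P^A. *)
pose s (o : option V) : A + 'I_1 :=
  if o is Some x then inl (inA (v x)) else inr ord0.
have sE (c : 'I_1 -> M) :
    (fun o => sumval val c (s o)) = optval (fun x => val (v x)) (c ord0).
  by apply/funext; case.
have [|d [dP]] :=
    complete_set_form A_complete (f := fNot (rename s (relativize f))).
  by exists (fun=> a); split=> //= /sat_rename; rewrite sE.
apply; apply/sat_rename; rewrite sE.
have /IH := h (SigSub (mem_set (dP ord0))).
by rewrite -optval_val.
Qed.

Lemma complete_set_elem_sub :
  complete_set A -> elem_sub (Pset A) (@interpP L M).
Proof.
move=> A_complete; exists (@subIsetr _ A (@interpP L M)) => n f v.
by rewrite complete_set_sat_substr// -sat_relativize.
Qed.

(* The trace of f on P is 0-definable inside P^M, where elementarity applies. *)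
Lemma elem_sub_witness n r (f : form L ('I_n + 'I_r)) (d : 'I_r -> A) :
  no_new_structure M -> elem_sub (Pset A) (@interpP L M) ->
  (forall j, Pset A (val (d j))) ->
  (exists a : 'I_n -> M, (forall i, interpP (a i)) /\
     sat f (sumval a (fun j => val (d j)))) ->
  exists a : 'I_n -> M, (forall i, Pset A (a i)) /\
     sat f (sumval a (fun j => val (d j))).
Proof.
move=> M_nns [AB elemAB] dP [a [aP fa]].
(* [g] says that all [n + r] variables lie in P, so that conjoining it with [f] defines a subset of
   a power of P. *)
have [g Hg] := finite_conjunction
  (finite_image (fun i : 'I_(n + r) => @fP L _ i) (@finite_finset _ setT)).
have gE (w : 'I_(n + r) -> M) : sat g w <-> forall i, interpP (w i).
  rewrite Hg; split=> [h i|h _ [i _ <-]]; last exact: h.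
  by apply: (h (fP i)); exists i.
pose X := [set w : 'I_(n + r) -> M |
  (forall i, interpP (w i)) /\ sat f (fun z => w (unsplit z))].
have [theta thetaE] : definable0 (M := substr (@interpP L M))
    [set w : 'I_(n + r) -> @interpP L M | X (fun i => val (w i))].
  apply: M_nns => [w []//|]; exists (fAnd g (rename (@unsplit n r) f)).
  apply/seteqP; split=> w; last by move=> /sat_fAnd[/gE wP /sat_rename fw].
  by move=> [/gE gw fw]; apply/sat_fAnd; split; last exact/sat_rename.
have Xtheta (w : 'I_(n + r) -> @interpP L M) :
    X (fun i => val (w i)) <-> @sat L (substr (@interpP L M)) _ theta w.
  by move/(congr1 (fun Y => Y w)): thetaE => /= ->.
(* [h] says of the parameters that some tuple satisfies [theta] with them. It holds at [d] in P^M,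
   hence in P^A, which yields [w]; a second use of elementarity returns [theta] to P^M, where it
   gives [f]. *)
have [h Hh] := sat_exists (rename (@fintype.split n r) theta).
pose d' j : Pset A := SigSub (mem_set (dP j)).
pose a' i : @interpP L M := SigSub (mem_set (aP i)).
have /elemAB/Hh[w] : @sat L (substr (@interpP L M)) _ h (fun j => subfun AB (d' j)).
  apply/Hh; exists a'; apply/sat_rename/Xtheta; split.
    by move=> i; apply: set_valP.
  move: fa; congr sat; apply/funext => z; rewrite unsplitK.
  by case: z.
move=> /sat_rename/elemAB/Xtheta[_ fw].
exists (fun i => val (w i)); split; first by move=> i; apply: set_valP.
move: fw; congr sat; apply/funext => z; rewrite unsplitK.
by case: z.
Qed.

Lemma consistent_set0U1 (f : form L ('I_0 + A)) :
  consistent (set0 `|` [set f]) -> exists x, sat f (sumval x val).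
Proof.
have fin : finite_set (set0 `|` [set f]) by rewrite finite_setU.
by move=> /(finite_consistentP fin)[x fx]; exists x; apply: fx; right.
Qed.

Lemma finite_partial_type_set0 :
  finite_partial_type (set0 : set (form L ('I_0 + A))).
Proof.
have x : 'I_0 -> M by case.
by split=> //; exists M, val; split=> //; exists x.
Qed.

End Completeness.

(** * The cycle of implications *)

Theorem theorem4p7 (L : language) (T : set (sentence L)) (K : Type)
    (C : structure L)
    (T_complete : complete_theory T)
    (T_P_infinite : P_infinite T)
    (C_monster : monster T K C)
    (C_stably_embedded : stably_embedded C)
    (C_no_new_structure : no_new_structure C)
    (T_qe : quantifier_elimination T)
    (Psi : uniform_definitions C)
    (A : set C) :
  [<->
    (* (i) *)
    complete_set A;
    (* (ii) *)
    forall (n : nat) (p0 : set (form L ('I_n + A))), finite_partial_type p0 ->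
      forall (k : nat) (m l : 'I_k -> nat)
        (psi : forall i, form L ('I_(n + m i) + 'I_(l i)))
        (b : forall i, 'I_(m i) -> A),
      exists d : forall i, 'I_(l i) -> A,
        (forall i j, Pset A (val (d i j))) /\
        consistent
          (p0 `|` range (fun i : 'I_k => witness_form (psi i) (b i) (d i)));
    (* (iii) *)
    forall (n : nat) (p0 : set (form L ('I_n + A))), finite_partial_type p0 ->
      forall (m l : nat) (psi : form L ('I_(n + m) + 'I_l)) (b : 'I_m -> A),
      exists d : 'I_l -> A,
        (forall j, Pset A (val (d j))) /\
        consistent (p0 `|` [set witness_form psi b d]);
    (* (iv) *)
    elem_sub (Pset A) (@interpP L C) /\
    forall (n : nat) (p0 : set (form L ('I_n + A))), finite_partial_type p0 ->
      forall (k : nat) (m l : 'I_k -> nat)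
        (psi : forall i, form L ('I_(n + m i) + 'I_(l i)))
        (b : forall i, 'I_(m i) -> A),
      exists d : forall i, 'I_(udef_len Psi (psi i)) -> A,
        (forall i j, Pset A (val (d i j))) /\
        consistent
          (p0 `|`
           range (fun i : 'I_k => definition_form Psi (psi i) (b i) (d i)));
    (* (v) *)
    elem_sub (Pset A) (@interpP L C) /\
    forall (n : nat) (p0 : set (form L ('I_n + A))), finite_partial_type p0 ->
      forall (m l : nat) (psi : form L ('I_(n + m) + 'I_l)) (b : 'I_m -> A),
      exists d : 'I_(udef_len Psi psi) -> A,
        (forall j, Pset A (val (d j))) /\
        consistent (p0 `|` [set definition_form Psi psi b d])
  ].
Proof.
(* [p] is the default entry of a tuple in P when a formula has no witness there and the implication
   holds vacuously. *)
have [p Pp] : @interpP L C !=set0.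
  by apply: infinite_setN0; apply: T_P_infinite; case: C_monster.
tfae.
- move=> A_complete n p0 p0fin k m l psi b.
  apply: (@extend_family _ _ _ _ p0 k (fun i => 'I_(l i) -> A)
    (fun i d => forall j, Pset A (val (d j)))
    (fun i d => witness_form (psi i) (b i) d)) => // i q qfin.
  (* [chi] is the witness formula itself, with the constants [b] on the left of [A + 'I_l] and the
     variables z, on the right, in place of [d]. *)
  apply: (complete_set_extend A_complete
    (chi := witness_form (psi i) (fun j => inl (b i j)) inr)) => // [d x|x].
    by rewrite !sat_witness_form.
  have [[w [wP hw]]|no] := pselect (exists w : 'I_(l i) -> C,
    (forall j, interpP (w j)) /\ sat (psi i) (sumval
      (fun j => sumval x (fun j => val (b i j)) (fintype.split j)) w)).
    by exists w; split=> //; apply/sat_witness_form.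
  by exists (fun=> p); split=> //; apply/sat_witness_form => /no.
- move=> h n p0 p0fin m l psi b.
  (* A single formula is a family indexed by ['I_1]. *)
  have [d [dP dcons]] := h n p0 p0fin 1 (fun=> m) (fun=> l) (fun=> psi) (fun=> b).
  exists (d ord0); split=> //; apply: sub_consistent dcons.
  by apply: setUS => _ ->; exists ord0.
- move=> h.
  have A_complete : complete_set A.
    move=> n m psi b [a [aP psia]].
    (* The swap is due to [complete_set] putting the tuple from P first, while [witness_form] puts
       it last. *)
    have [d [dP /consistent_set0U1[x]]] := h 0 set0 (finite_partial_type_set0 A)
      m n (rename (sumval inr inl) psi) b.
    move=> /sat_witness_form; rewrite sumval_split0 sat_rename_swap => hd.
    exists (fun i => val (d i)); split=> //; apply: hd.
    by exists a; split=> //; apply/sat_rename_swap.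
  split; first exact: complete_set_elem_sub.
  move=> n p0 p0fin k m l psi b.
  apply: (@extend_family _ _ _ _ p0 k (fun i => 'I_(udef_len Psi (psi i)) -> A)
    (fun i d => forall j, Pset A (val (d j)))
    (fun i d => definition_form Psi (psi i) (b i) d)) => // i q qfin.
  apply: (complete_set_extend A_complete
    (chi := definition_form Psi (psi i) (fun j => inl (b i j)) inr)) => // [d x|x].
    by rewrite !sat_definition_form.
  (* The uniform definition is taken at the joined tuple [(x, b)], so [c] depends on [x]. *)
  have [c [cP /sat_allP hc]] := udefP Psi (psi i)
    (fun j => sumval x (fun j => val (b i j)) (fintype.split j)).
  exists c; split=> //; apply/sat_definition_form => w wP.
  by have /sat_def_equiv := hc w wP.
- move=> [elemA h]; split=> // n p0 p0fin m l psi b.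
  have [d [dP dcons]] := h n p0 p0fin 1 (fun=> m) (fun=> l) (fun=> psi) (fun=> b).
  exists (d ord0); split=> //; apply: sub_consistent dcons.
  by apply: setUS => _ ->; exists ord0.
- move=> [elemA h] n m psi b [a [aP psia]].
  have [d [dP /consistent_set0U1[x]]] := h 0 set0 (finite_partial_type_set0 A)
    m n (rename (sumval inr inl) psi) b.
  move=> /sat_definition_form; rewrite sumval_split0 => hd.
  (* [hd] is used in both directions: at [a] to pass from [psi] to its definition, and at [u], found
     in P^A, to come back. *)
  have [|u [uP hu]] := elem_sub_witness C_no_new_structure elemA dP
    (f := udef Psi (rename (sumval inr inl) psi)).
    by exists a; split=> //; apply/hd => //; apply/sat_rename_swap.
  exists u; split=> //; apply/sat_rename_swap/hd => // i.
  by have [] := uP i.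
Qed.
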